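(* For every $\alpha\in(0,1]$ there exist constants $C,c>0$ (depending only on $\alpha$) such that the following holds. Let $n\ge k\ge 1$ be integers and let $\mu:\binom{[n]}{k}\to\mathbb{R}_{\ge0}$ be a density, not identically zero, whose generating polynomial $g_\mu(z_1,\dots,z_n)=\sum_{S}\mu(S)\prod_{i\in S}z_i$ is $\Gamma_\alpha$-stable. Then there is an integer $\ell$ with $\max(0,k-C)\le \ell\le k$ such that the $k\leftrightarrow\ell$ down-up random walk for $\mu$ has relaxation time at most $C\,k^{c}$.
   Context: For $\alpha>0$, $\Gamma_\alpha=\{\exp(x+iy): x\in\mathbb{R},\ y\in(-\alpha\pi/2,\alpha\pi/2)\}\subseteq\mathbb{C}$ is the open sector of aperture $\alpha\pi$ around the positive real axis. A polynomial $g\in\mathbb{C}[z_1,\dots,z_n]$ is $\Gamma_\alpha$-stable if $g(z_1,\dots,z_n)\neq0$ whenever $z_1,\dots,z_n\in\Gamma_\alpha$ (the identically zero polynomial is also called stable). For $\ell\le k$, the $k\leftrightarrow\ell$ down-up walk for $\mu$ moves from a set $S_t$ (with $\mu(S_t)>0$) by choosing $T_t$ uniformly among the $\ell$-subsets of $S_t$, then choosing $S_{t+1}$ among the $k$-element supersets of $T_t$ with probability proportional to $\mu(S_{t+1})$. This chain is reversible with respect to $\mu$ and has nonnegative real eigenvalues; its relaxation time is $1/(1-\lambda_2)$, where $\lambda_2$ is the second largest eigenvalue of its transition matrix. The statement formalizes the paper's ''sector of aperture $\Omega(1)$ implies relaxation time $k^{O(1)}$ for an appropriate $\ell=k-O(1)$''.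 *)

(* Defs.v *)
From mathcomp Require Import all_boot all_order all_algebra.
From mathcomp Require Import all_classical all_reals all_analysis.
From mathcomp Require Export complex polyrcf.
(* The notations of mpoly clash with those of MathComp-Analysis. *)
From mathcomp Require Export -(notations) mpoly.

Set Implicit Arguments.
Unset Strict Implicit.
Unset Printing Implicit Defensive.

Import Order.TTheory GRing.Theory Num.Theory.

Local Open Scope classical_set_scope.
Local Open Scope ring_scope.
Local Open Scope complex_scope.

Section Stability.
Variable R : realType.

Definition cexp (x y : R) : R[i] := (expR x * cos y) +i* (expR x * sin y).

Definition sector (alpha : R) : set R[i] :=
  [set z | exists x y : R,
     [/\ - (alpha * pi / 2) < y, y < alpha * pi / 2 & z = cexp x y]].

Definition sector_stable (alpha : R) n (g : mpoly n R[i]) : Prop :=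
  g = 0 \/
  forall z : 'I_n -> R[i], (forall i, sector alpha (z i)) -> meval z g != 0.

End Stability.

Notation ksubset n k := {S : {set 'I_n} | #|S| == k}.

Section DownUpWalk.
Variables (R : realType) (n k : nat).
Implicit Type mu : ksubset n k -> R.

(* mpolyX _ (mnm1 i) is the variable z_i. *)
Definition gen_poly mu : mpoly n R[i] :=
  \sum_(S : ksubset n k)
    (mu S)%:C *: \prod_(i in val S) (mpolyX R[i] (mnm1 i) : mpoly n R[i]).

Definition down_prob (l : nat) (S : ksubset n k) (T : ksubset n l) : R :=
  if val T \subset val S then 'C(k, l)%:R^-1 else 0.

Definition up_prob mu (l : nat) (T : ksubset n l) (S : ksubset n k) : R :=
  if val T \subset val S
  then mu S / \sum_(S' : ksubset n k | val T \subset val S') mu S'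
  else 0.

Definition walk_states mu : {set ksubset n k} := [set S | 0 < mu S]%SET.

Definition down_up_matrix mu (l : nat) : 'M[R]_#|walk_states mu| :=
  \matrix_(i, j) \sum_(T : ksubset n l)
    down_prob (enum_val i) T * up_prob mu T (enum_val j).

End DownUpWalk.

Section Relaxation.
Variables (R : realType) (N : nat).
Implicit Type P : 'M[R]_N.

(* The real eigenvalues in nonincreasing order, repeated according to their
   algebraic multiplicity; rootsR lists the distinct roots increasingly.
   For a reversible chain these are all the complex eigenvalues. *)
Definition eigenvalues P : seq R :=
  flatten [seq nseq (mup x (char_poly P)) x | x <- rev (rootsR (char_poly P))].

(* A one-state chain has no second eigenvalue; the value is then 0, so that its
   relaxation time is 1. *)
Definition second_eigenvalue P : R := nth 0 (eigenvalues P) 1.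

(* The inverse of 0 is 0 in a field, hence the explicit +oo. *)
Definition relaxation_time P : \bar R :=
  if second_eigenvalue P < 1 then ((1 - second_eigenvalue P)^-1)%:E
  else +oo%E.

End Relaxation.

(* Main.v *)
Require Import Defs.
From mathcomp Require Import all_boot all_order all_algebra.
From mathcomp Require Import all_classical all_reals all_analysis.
From mathcomp Require Import ring lra zify.

(** The sector contains a cone [|Im z| <= d Re z] around the positive axis.  Fix
    an element i, substitute z_j = 1 + (d/2) eps_j u for j <> i and write the
    generating polynomial as A(u) z_i + B(u).  After rescaling z_i so that
    A(0) = B(0), stability for z_i near 1 bounds A / (A + B) on the unit disc, so
    a Cauchy estimate at u = 0 bounds the signed influence sums
    [sum_j eps_j Cov(i, j)] by a constant times P(i).  The conditional measures
    on the supersets of T are limits of external fields, so they satisfy the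
    same bound.  Hence Var(sum_{i in S} h_i) <= K sum_i P(i) h_i^2 in every link:
    revealing one element of a random r-set reduces the mean conditional variance
    by a factor at least 1 - K/r.  Multiplying over r = k, ..., K + 1 gives the
    spectral gap 1 / binom(k, K) for l = k - K.  *)

Set Implicit Arguments.
Unset Strict Implicit.
Unset Printing Implicit Defensive.

Import Order.TTheory GRing.Theory Num.Theory.

Local Open Scope ring_scope.

(** * A Cauchy estimate for rational functions *)

Section CauchyEstimate.
Variable C : numClosedFieldType.
Implicit Types (p : {poly C}) (f : C -> C).

Lemma horner_even_poly p x : (even_poly p).[x ^+ 2] = (p.[x] + p.[- x]) / 2.
Proof.
rewrite -{2 3}[p]poly_even_odd !(hornerD, horner_comp, hornerM, hornerX, hornerXn).
by rewrite mulrNN -expr2; field.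
Qed.

(* Averaging p(y) and p(-y) keeps the value at 0 and halves the degree in x = y^2. *)
Lemma poly_circle_bound p M :
  (forall x, `|x| = 1 -> `|p.[x]| <= M) -> `|p.[0]| <= M.
Proof.
have [m] := ubnP (size p); elim: m p => // m IHm p; rewrite ltnS => szp pM.
have [sz1|sz1] := leqP (size p) 1.
  have := pM 1 (normr1 _); move/size1_polyC: sz1 => ->.
  by rewrite !hornerC.
have -> : p.[0] = (even_poly p).[0].
  have := horner_even_poly p 0; rewrite expr0n /= oppr0 => ->; by field.
apply: IHm => [|x x1].
  apply: leq_ltn_trans (size_even_poly p) _.
  by apply: leq_trans szp; rewrite uphalf_half; lia.
have sx1 : `|sqrtC x| = 1.
  by apply/eqP; rewrite -(@pexpr_eq1 _ _ 2)// -normrX sqrtCK x1.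
rewrite -[x]sqrtCK horner_even_poly normrM normfV normr_nat ler_pdivrMr//.
apply: le_trans (ler_normD _ _) _; rewrite mulr2n mulrDr mulr1 lerD ?pM//.
by rewrite normrN.
Qed.

(* c is the value at 0 of the holomorphic extension of f to the disc. *)
Definition circle_limit f (c : C) :=
  (exists2 B, 0 <= B & forall x, `|x| = 1 -> `|f x| <= B) /\
  forall e, 0 < e ->
    exists2 p, p.[0] = c & forall x, `|x| = 1 -> `|f x - p.[x]| <= e.

(** The maximum principle for polynomials survives uniform approximation: if |c| exceeded M, a
    polynomial within half the gap would violate [poly_circle_bound]. *)
Lemma circle_limit_bound f c M :
  circle_limit f c -> (forall x, `|x| = 1 -> `|f x| <= M) -> `|c| <= M.
Proof.
move=> [_ fc] fM.
have c_real : `|c| \is Num.real by apply: normr_real.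
have M_real : M \is Num.real.
  by rewrite ger0_real// (le_trans _ (fM 1 (normr1 _))).
rewrite real_leNgt//; apply/negP => Mc.
have e0 : 0 < (`|c| - M) / 2 by rewrite divr_gt0 ?subr_gt0.
have [p pc pf] := fc _ e0.
suff : `|c| <= M + (`|c| - M) / 2.
  rewrite -subr_ge0.
  have -> : M + (`|c| - M) / 2 - `|c| = - ((`|c| - M) / 2) by field.
  by rewrite oppr_ge0 => /(lt_le_trans e0); rewrite ltxx.
rewrite -pc; apply: poly_circle_bound => x x1.
rewrite -[p.[x]](subrK (f x)) addrC (le_trans (ler_normD _ _))//.
by rewrite pc lerD ?fM// distrC pf.
Qed.

Lemma poly_bounded p : exists2 B, 0 <= B & forall x, `|x| = 1 -> `|p.[x]| <= B.
Proof.
elim/poly_ind: p => [|p c [B B0 pB]].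
  by exists 0 => // x _; rewrite horner0 normr0.
exists (B + `|c|) => [|x x1]; first by rewrite addr_ge0.
rewrite hornerMXaddC (le_trans (ler_normD _ _))// lerD//.
by rewrite normrM x1 mulr1 pB.
Qed.

Lemma circle_limit_poly p : circle_limit (horner p) p.[0].
Proof.
split; first exact: poly_bounded.
by move=> e e0; exists p => // x _; rewrite subrr normr0 ltW.
Qed.

Lemma circle_limitM f g c d :
  circle_limit f c -> circle_limit g d ->
  circle_limit (fun x => f x * g x) (c * d).
Proof.
move=> [[B B0 fB] fc] [[D D0 gD] gd]; split.
  exists (B * D) => [|x x1]; first by rewrite mulr_ge0.
  by rewrite normrM ler_pM// ?fB ?gD.
move=> e e0.
(* [q] is chosen first, because the tolerance for [p] depends on the bound of [q] on the circle. The
   added 1 keeps the denominators positive. *)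
have [q qd gq] := gd (e / 2 / (B + 1)) ltac:(by rewrite !divr_gt0// ltr_wpDl).
have [D' D'0 qD'] := poly_bounded q.
have [p pc fp] := fc (e / 2 / (D' + 1)) ltac:(by rewrite !divr_gt0// ltr_wpDl).
exists (p * q) => [|x x1]; first by rewrite hornerM pc qd.
have -> : f x * g x - (p * q).[x] =
    f x * (g x - q.[x]) + (f x - p.[x]) * q.[x] by rewrite hornerM; ring.
rewrite (le_trans (ler_normD _ _))// [e]splitr.
have half (u v b : C) : 0 <= b -> `|u| <= b -> `|v| <= e / 2 / (b + 1) ->
    `|u| * `|v| <= e / 2.
  move=> b0 ub vb; have b1 : 0 < b + 1 by rewrite ltr_wpDl.
  rewrite -[leRHS](@mulfVK _ (b + 1)) ?gt_eqF// mulrC ler_pM//.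
  by rewrite (le_trans ub)// lerDl.
by rewrite !normrM lerD//; [apply: (half _ _ B)|rewrite mulrC; apply: (half _ _ D')];
   rewrite ?fB ?gq ?qD' ?fp.
Qed.

Hypothesis C_archi : forall x : C, exists n : nat, `|x| <= n%:R.

(** Bernoulli's inequality gives linear growth of the powers of 1/q. An abstract closed field may be
    non-Archimedean, so [C_archi] supplies the unboundedness. *)
Lemma expr_small (q e : C) : 0 <= q < 1 -> 0 < e -> exists n, q ^+ n <= e.
Proof.
move=> /andP[q0 q1] e0.
have [->|qn0] := eqVneq q 0; first by exists 1; rewrite expr1 ltW.
have {qn0}q0 : 0 < q by rewrite lt_def qn0.
have x0 : 0 < q^-1 - 1 by rewrite subr_gt0 invf_gt1.
have bernoulli n : 1 + n%:R * (q^-1 - 1) <= q^-1 ^+ n.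
  elim: n => [|n IHn]; first by rewrite mul0r addr0 expr0.
  rewrite exprS -(ler_pM2l (x := q^-1)) ?invr_gt0// in IHn *.
  apply: le_trans IHn; rewrite -subr_ge0.
  set y := q^-1 in x0 *.
  have -> : y * (1 + n%:R * (y - 1)) - (1 + n.+1%:R * (y - 1)) =
     n%:R * (y - 1) ^+ 2 by rewrite -natr1; ring.
  by rewrite mulr_ge0// exprn_ge0// ltW.
have [n nP] := C_archi (e^-1 / (q^-1 - 1)).
exists n; rewrite -[q ^+ n]invrK -[leRHS]invrK lef_pV2 ?posrE ?invr_gt0 ?exprn_gt0//.
rewrite -exprVn (le_trans _ (bernoulli n))//.
move: nP; rewrite ger0_norm ?divr_ge0 ?invr_ge0 ?(ltW e0) ?(ltW x0)//.
rewrite ler_pdivrMr// => /le_trans; apply; by rewrite lerDr ler01.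
Qed.

(** The approximants are partial sums of the geometric series; the remainder (x/a)^(n+1) / (x - a)
    is uniformly small on the circle. *)
Lemma circle_limit_inv a : 1 < `|a| -> circle_limit (fun x => (x - a)^-1) (- a)^-1.
Proof.
move=> a1; have a0 : a != 0 by rewrite -normr_gt0 (lt_trans ltr01).
have da : 0 < `|a| - 1 by rewrite subr_gt0.
have xaB x : `|x| = 1 -> `|a| - 1 <= `|x - a|.
  by move=> <-; rewrite distrC lerB_dist.
have xa0 x : `|x| = 1 -> x - a != 0.
  by move=> /xaB/(lt_le_trans da); rewrite normr_gt0.
have inv_bound x : `|x| = 1 -> `|(x - a)^-1| <= (`|a| - 1)^-1.
  by move=> x1; rewrite normfV lef_pV2 ?posrE ?xaB// normr_gt0 xa0.
split.
  by exists (`|a| - 1)^-1; rewrite ?invr_ge0 ?(ltW da).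
move=> e e0.
have [||n nP] := @expr_small (`|a|^-1) (e * (`|a| - 1)).
- by rewrite invr_ge0 normr_ge0 invf_lt1// (lt_trans ltr01).
- by rewrite mulr_gt0.
exists ((- a)^-1 *: \sum_(i < n.+1) (a^-1 *: 'X) ^+ i) => [|x x1].
  rewrite hornerZ horner_sum big_ord_recl expr0 hornerC big1 ?addr0 ?mulr1//.
  by move=> i _; rewrite horner_exp hornerZ hornerX mulr0 exprS mul0r.
rewrite hornerZ.
have -> : (\sum_(i < n.+1) (a^-1 *: 'X) ^+ i).[x] = \sum_(i < n.+1) (a^-1 * x) ^+ i.
  by rewrite horner_sum; apply: eq_bigr => i _; rewrite horner_exp hornerZ hornerX.
have -> : (x - a)^-1 - (- a)^-1 * (\sum_(i < n.+1) (a^-1 * x) ^+ i) =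
    (a^-1 * x) ^+ n.+1 * (x - a)^-1.
  have := subrX1 (a^-1 * x) n.+1; set S := \sum_(i < _) _ => SE.
  have -> : (a^-1 * x) ^+ n.+1 = 1 + (a^-1 * x - 1) * S by rewrite -SE; ring.
  by field; rewrite a0 xa0.
rewrite normrM normrX normrM normfV x1 mulr1.
rewrite (le_trans (ler_wpM2l _ (inv_bound x x1))) ?exprn_ge0 ?invr_ge0//.
rewrite ler_pdivrMr// (le_trans _ nP)// exprS ler_piMl ?exprn_ge0 ?invr_ge0//.
by rewrite invf_le1 ?(ltW a1)// (lt_trans ltr01).
Qed.

Lemma eq_circle_limit f g c d :
  f =1 g -> c = d -> circle_limit f c -> circle_limit g d.
Proof.
move=> fg <- [[B B0 fB] fc]; split; first by exists B => // x; rewrite -fg; apply: fB.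
by move=> e /fc[p pc pf]; exists p => // x; rewrite -fg; apply: pf.
Qed.

Lemma circle_limit_prod (s : seq C) :
  (forall a, a \in s -> 1 < `|a|) ->
  circle_limit (fun x => (\prod_(a <- s) ('X - a%:P)).[x]^-1)
               (\prod_(a <- s) ('X - a%:P)).[0]^-1.
Proof.
elim: s => [|a s IHs] s1.
  apply: eq_circle_limit (circle_limit_poly 1) => [x|];
  by rewrite big_nil !hornerC invr1.
have s1' b : b \in s -> 1 < `|b| by move=> bs; rewrite s1// inE bs orbT.
have := circle_limitM (circle_limit_inv (s1 a (mem_head _ _))) (IHs s1').
apply: eq_circle_limit => [x|];
by rewrite big_cons hornerM hornerXsubC invfM// sub0r.
Qed.

(** Over a closed field q splits into linear factors. Its roots lie outside the closed disc, so each
    inverse factor is covered by [circle_limit_inv]. *)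
Lemma circle_limit_frac p q :
  (forall x, `|x| <= 1 -> q.[x] != 0) ->
  circle_limit (fun x => p.[x] / q.[x]) (p.[0] / q.[0]).
Proof.
move=> q0; have [s qE] := closed_field_poly_normal q.
have lq0 : lead_coef q != 0.
  apply: contraNneq (q0 0 ltac:(by rewrite normr0)) => l0.
  by rewrite qE l0 scale0r horner0.
have s1 a : a \in s -> 1 < `|a|.
  move=> sa; rewrite real_ltNge ?normr_real ?real1//; apply/negP => /q0.
  by rewrite qE -rootE rootZ// root_prod_XsubC sa.
have := circle_limitM (circle_limit_poly ((lead_coef q)^-1 *: p)) (circle_limit_prod s1).
by apply: eq_circle_limit => [x|]; rewrite {2}qE !hornerZ invfM mulrCA mulrA.
Qed.

Lemma frac_disc_bound p q M :
  (forall x, `|x| <= 1 -> q.[x] != 0) ->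
  (forall x, `|x| = 1 -> `|p.[x]| <= M * `|q.[x]|) ->
  `|p.[0]| <= M * `|q.[0]|.
Proof.
move=> q0 pM.
rewrite -ler_pdivrMr -?normfV -?normrM ?normr_gt0 ?q0 ?normr0//.
apply: circle_limit_bound (circle_limit_frac p q0) _ => x x1.
by rewrite normrM normfV ler_pdivrMr ?pM ?normr_gt0 ?q0 ?x1.
Qed.

(** This bounds the derivative of p/q at 0, as in the Schwarz lemma: q(0) p - p(0) q is divisible by
    X, and the maximum principle applies to its quotient by X q. Its two terms account for the
    factor 2. *)
Lemma frac_cauchy_estimate p q M :
  (forall x, `|x| <= 1 -> q.[x] != 0) ->
  (forall x, `|x| <= 1 -> `|p.[x]| <= M * `|q.[x]|) ->
  `|p`_1 * q`_0 - p`_0 * q`_1| <= M *+ 2 * `|q`_0| ^+ 2.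
Proof.
move=> q0 pM; pose r := q`_0 *: p - p`_0 *: q.
have r0 : r`_0 = 0 by rewrite coefB !coefZ; ring.
have /factor_theorem[r' rE] : root r 0 by rewrite rootE -horner_coef0 in r0 *; apply/eqP.
have -> : p`_1 * q`_0 - p`_0 * q`_1 = r'.[0].
  have -> : r'.[0] = r`_1 by rewrite rE subr0 coefMX horner_coef0.
  by rewrite coefB !coefZ; ring.
have pq0 : `|p`_0| <= M * `|q`_0|.
  by rewrite -!horner_coef0; apply: frac_disc_bound => // x x1; rewrite pM// x1.
rewrite expr2 mulrA -{2}horner_coef0; apply: frac_disc_bound => // x x1.
have -> : `|r'.[x]| = `|r.[x]|.
  by rewrite rE hornerM subr0 hornerX normrM x1 mulr1.
rewrite /r hornerD hornerN !hornerZ (le_trans (ler_normB _ _))// !normrM.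
rewrite mulr2n !mulrDl lerD ?ler_wpM2r//.
by rewrite [M * _]mulrC -mulrA ler_wpM2l// pM ?x1.
Qed.
End CauchyEstimate.

(** * Influences of cone-stable measures *)

Section Cone.
Local Open Scope complex_scope.
Variable R : realType.
Implicit Types (x d : R) (z v : R[i]).

Lemma complex_archi z : exists n : nat, `|z| <= n%:R.
Proof.
rewrite normc_def; set x := Num.sqrt _; exists (Num.bound x).
have -> : (Num.bound x)%:R = ((Num.bound x)%:R : R)%:C by rewrite rmorph_nat.
by rewrite lecR ltW// archi_boundP// sqrtr_ge0.
Qed.

Lemma normc_realC x : `|x%:C| = `|x|%:C.
Proof. by rewrite normc_def /= expr0n addr0 sqrtr_sqr. Qed.

Lemma Im_le_normc z : `|complex.Im z|%:C <= `|z|.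
Proof. by rewrite normc_def lecR -sqrtr_sqr ler_wsqrtr// lerDr sqr_ge0. Qed.

(** The sector |arg z| <= arctan d in algebraic form. For d <= 1 it contains the disc of radius d/2
    about 1, where Re z >= 1/2. *)
Definition cone d z := (0 < complex.Re z) && (`|complex.Im z| <= d * complex.Re z).

Lemma coneZ d x z : 0 < x -> cone d z -> cone d (x%:C * z).
Proof.
case: z => a b x0 /andP[/= a0 bd]; rewrite /cone /= !mul0r subr0 addr0.
by rewrite mulr_gt0// normrM gtr0_norm// mulrCA ler_wpM2l// ltW.
Qed.

Lemma cone_near1 d v : 0 < d <= 1 -> `|v| <= (d / 2)%:C -> cone d (1 + v).
Proof.
move=> /andP[d0 d1] vd.
have := le_trans (normc_ge_Re v) vd; have := le_trans (Im_le_normc v) vd.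
rewrite !lecR /cone; case: v {vd} => a b /=.
rewrite add0r [`|a| <= _]ler_norml => vb /andP[a1 _].
apply/andP; split; first lra.
apply: le_trans vb _; nra.
Qed.

End Cone.

Section LinearFactors.
Variables (C : comNzRingType) (I : Type) (c : I -> C).

Lemma coef01_prod_linear (s : seq I) (P : pred I) :
  let p := \prod_(j <- s | P j) (1 + c j *: 'X) in
  p`_0 = 1 /\ p`_1 = \sum_(j <- s | P j) c j.
Proof.
elim: s => [|j s [IH0 IH1]] /=; first by rewrite !big_nil !coefC.
rewrite !big_cons; case: (P j) => //.
rewrite !mulrDl !mul1r !coefD -!scalerAl !coefZ !coefXM /= IH0 IH1.
by rewrite mulr0 mulr1 addr0 addrC.
Qed.

End LinearFactors.

(** * Moments of weights on k-sets *)

Section Moments.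
Variables (n k : nat).
Section Ring.
Variable V : comNzRingType.
Implicit Types (w : ksubset n k -> V) (i j : 'I_n).

Definition total w := \sum_(S : ksubset n k) w S.
Definition mass1 w i := \sum_(S : ksubset n k | i \in val S) w S.
Definition mass2 w i j := \sum_(S : ksubset n k | (i \in val S) && (j \in val S)) w S.

(** The covariance of the indicators of i and j, multiplied by the squared total mass. Being free of
    division, it makes sense for polynomial weights and commutes with evaluation. *)
Definition cov w i j := total w * mass2 w i j - mass1 w i * mass1 w j.

Lemma total_mass1 w i : total w - mass1 w i = \sum_(S : ksubset n k | i \notin val S) w S.
Proof.
rewrite /total /mass1 (bigID (fun S : ksubset n k => i \in val S)) /=.
by rewrite addrAC subrr add0r.
Qed.

Lemma mass1_mass2 w i j :
  mass1 w j - mass2 w i j =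
  \sum_(S : ksubset n k | (i \notin val S) && (j \in val S)) w S.
Proof.
rewrite /mass1 (bigID (fun S : ksubset n k => i \in val S)) /=.
under eq_bigl do rewrite andbC.
rewrite addrC addrK; by under eq_bigl do rewrite andbC.
Qed.

Lemma covC w i j : cov w i j = cov w j i.
Proof.
by rewrite /cov [mass1 w i * _]mulrC /mass2; under eq_bigl do rewrite andbC.
Qed.

Lemma mass2ii w i : mass2 w i i = mass1 w i.
Proof. by apply: eq_bigl => S; rewrite andbb. Qed.

End Ring.

Section Morphism.
Variables (V V' : comNzRingType) (phi : {rmorphism V -> V'}).
Implicit Types (w : ksubset n k -> V) (i j : 'I_n).

Lemma total_morph w : phi (total w) = total (phi \o w).
Proof. exact: rmorph_sum. Qed.

Lemma mass1_morph w i : phi (mass1 w i) = mass1 (phi \o w) i.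
Proof. exact: rmorph_sum. Qed.

Lemma cov_morph w i j : phi (cov w i j) = cov (phi \o w) i j.
Proof.
rewrite /cov rmorphB !rmorphM total_morph !mass1_morph; congr (_ * _ - _).
exact: rmorph_sum.
Qed.

End Morphism.
End Moments.

Section Influence.
Local Open Scope complex_scope.
Variables (R : realType) (n k : nat).
Implicit Types (w : ksubset n k -> R) (d : R).

Definition cone_stable d w := forall z : 'I_n -> R[i],
  (forall i, cone d (z i)) ->
  \sum_(S : ksubset n k) (w S)%:C * \prod_(i in val S) z i != 0.

(** If i has probability 0 or 1, its indicator is almost surely constant. This is the case in which
    the rescaling by B / A in [influence_bound] breaks down. *)
Lemma cov_degenerate w i j : (forall S, 0 <= w S) ->
  mass1 w i * (total w - mass1 w i) = 0 -> cov w i j = 0.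
Proof.
move=> w0 /eqP; rewrite mulf_eq0 => /orP[]/eqP.
  move=> Ai; rewrite /cov Ai mul0r.
  have /(_ _ _)wS := psumr_eq0P (fun (S : ksubset n k) (_ : i \in val S) => w0 S) Ai.
  by rewrite /mass2 big1 ?mulr0 ?subr0// => S /andP[iS _]; apply: wS.
move=> Ti; have TA : total w = mass1 w i by apply/eqP; rewrite -subr_eq0 Ti.
rewrite total_mass1 in Ti.
have wS := psumr_eq0P (fun (S : ksubset n k) (_ : i \notin val S) => w0 S) Ti.
rewrite /cov TA -mulrBr -opprB mass1_mass2 big1 ?oppr0 ?mulr0// => S /andP[iS _].
exact: wS.
Qed.

Lemma influence_bound d w (eps : 'I_n -> R) i :
  0 < d <= 1 -> (forall S, 0 <= w S) -> cone_stable d w ->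
  (forall j, `|eps j| <= 1) ->
  `|\sum_(j | j != i) eps j * cov w i j| <=
  32 / d ^+ 2 * (mass1 w i * (total w - mass1 w i)).
Proof.
move=> d01 w0 stab eps1.
set A := mass1 w i; set B := total w - A.
have A0 : 0 <= A by apply: sumr_ge0.
have B0 : 0 <= B by rewrite /B total_mass1; apply: sumr_ge0.
have [AB0|ABn0] := eqVneq (A * B) 0.
  rewrite AB0 mulr0 big1 ?normr0// => j _.
  by rewrite cov_degenerate ?mulr0.
have {}A0 : 0 < A by rewrite lt_def A0 andbT; apply: contraNneq ABn0 => ->; rewrite mul0r.
have {}B0 : 0 < B by rewrite lt_def B0 andbT; apply: contraNneq ABn0 => ->; rewrite mulr0.
move: (d01) => /andP[d0 d1].
pose h := d / 2; have h0 : 0 < h by rewrite divr_gt0.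
pose c j := (h * eps j)%:C.
pose lin (S : ksubset n k) : {poly R[i]} :=
  \prod_(j in val S | j != i) (1 + c j *: 'X).
pose a := \sum_(S : ksubset n k | i \in val S) (w S)%:C *: lin S.
pose b := \sum_(S : ksubset n k | i \notin val S) (w S)%:C *: lin S.
(* At u = 0 the scaling by [r] gives [p] and [b] the common value B, so q(0) = 2B. *)
pose r := B / A; have r0 : 0 < r by rewrite divr_gt0.
pose p := r%:C *: a; pose q := b + p.
have lin_coef (S : ksubset n k) := coef01_prod_linear c (index_enum 'I_n)
  (fun j => (j \in val S) && (j != i)).
have lin0 S : (lin S)`_0 = 1 by have [] := lin_coef S.
have lin1 S : (lin S)`_1 = \sum_(j in val S | j != i) c j
  by have [] := lin_coef S.
have coef0_sum (Q : pred (ksubset n k)) :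
    (\sum_(S : ksubset n k | Q S) (w S)%:C *: lin S)`_0 =
    (\sum_(S : ksubset n k | Q S) w S)%:C.
  rewrite coef_sum rmorph_sum; apply: eq_bigr => S _.
  by rewrite coefZ lin0 mulr1.
have coef1_sum (Q : pred (ksubset n k)) :
    (\sum_(S : ksubset n k | Q S) (w S)%:C *: lin S)`_1 =
    (h * \sum_(j | j != i) eps j * \sum_(S : ksubset n k | Q S && (j \in val S)) w S)%:C.
  rewrite coef_sum.
  under eq_bigr do rewrite coefZ lin1 -rmorph_sum -rmorphM.
  rewrite -rmorph_sum; congr (_%:C); rewrite mulr_sumr.
  under eq_bigr do rewrite big_mkcondl mulr_sumr.
  rewrite exchange_big; apply: eq_bigr => j _.
  rewrite [in RHS]big_mkcondr !mulr_sumr; apply: eq_bigr => S _.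
  by case: ifP => _; rewrite ?mulr0//; ring.
(* q(u) + s p(u) is the generating polynomial at z_i = r (1 + s) and z_j = 1 + h eps_j u, all of
   which lie in the cone. *)
have stab_pq u s : `|u| <= 1 -> `|s| <= h%:C -> q.[u] + s * p.[u] != 0.
  move=> u1 sh; pose z j := if j == i then r%:C * (1 + s) else 1 + c j * u.
  have zC j : cone d (z j).
    rewrite /z; case: ifP => _; first by rewrite coneZ// cone_near1.
    rewrite cone_near1// normrM normc_realC normrM (gtr0_norm h0) -[leRHS]mulr1.
apply: ler_pM => //; first by rewrite ler0c mulr_ge0// ltW.
    by rewrite lecR -/h -[leRHS]mulr1 ler_wpM2l// ltW.
  have linz S : (lin S).[u] = \prod_(j in val S | j != i) z j.
    rewrite horner_prod; apply: eq_bigr => j /andP[_ /negbTE ji].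
    by rewrite /z ji hornerD hornerC hornerZ hornerX.
  apply: contra_neq (stab z zC) => qsp; rewrite -[RHS]qsp {qsp}.
  rewrite (bigID (fun S : ksubset n k => i \in val S)) /= addrC.
  rewrite /q hornerD -addrA; congr (_ + _).
    rewrite /b horner_sum; apply: eq_bigr => S iS.
    rewrite hornerZ linz; congr (_ * _); apply: eq_bigl => j.
    by case: (eqVneq j i) => [->|]; rewrite ?andbT// (negbTE iS).
  have -> : p.[u] + s * p.[u] = r%:C * (1 + s) * a.[u] by rewrite /p hornerZ; ring.
  rewrite /a horner_sum mulr_sumr; apply: eq_bigr => S iS.
  by rewrite hornerZ linz (bigD1 i)//= {1}/z eqxx mulrCA.
have q0 u : `|u| <= 1 -> q.[u] != 0.
  move=> u1; have := stab_pq u 0 u1; rewrite normr0 mul0r addr0; apply.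
  by rewrite ler0c ltW.
have pq u : `|u| <= 1 -> `|p.[u]| <= h^-1%:C * `|q.[u]|.
  move=> u1; rewrite real_leNgt ?realM ?normr_real ?realE ?ler0c ?invr_ge0 ?(ltW h0)//.
  apply/negP => qp.
  have p0 : p.[u] != 0.
    rewrite -normr_gt0 (le_lt_trans _ qp)// mulr_ge0// ler0c.
    by rewrite invr_ge0 ltW.
  (* If |p| > |q| / h, then s = -q/p is an admissible perturbation at which the polynomial
     vanishes. *)
  suff /(stab_pq u _ u1) : `|- (q.[u] / p.[u])| <= h%:C.
    by rewrite mulNr divfK// subrr eqxx.
  rewrite normrN normrM normfV ler_pdivrMr ?normr_gt0// ltW//.
  have hV0 : 0 < (h^-1)%:C by rewrite ltcR invr_gt0.
  have hVh : (h^-1)%:C * h%:C = 1 by rewrite -(rmorphM (real_complex R)) /= mulVf ?gt_eqF.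
  by rewrite -(ltr_pM2l hV0) mulrA hVh mul1r.
have := frac_cauchy_estimate (@complex_archi R) q0 pq.
have a0 : a`_0 = A%:C by rewrite coef0_sum.
have b0 : b`_0 = B%:C by rewrite coef0_sum /B total_mass1.
pose a1 := h * \sum_(j | j != i) eps j * mass2 w i j.
pose b1 := h * \sum_(j | j != i) eps j * (mass1 w j - mass2 w i j).
have a1E : a`_1 = a1%:C by rewrite coef1_sum.
have b1E : b`_1 = b1%:C.
  rewrite coef1_sum; congr (_ * _)%:C; apply: eq_bigr => j _.
  by rewrite mass1_mass2.
rewrite /q !coefD !coefZ a0 b0 a1E b1E -!rmorphM -!rmorphD -!rmorphM -rmorphB.
rewrite !normc_realC -rmorphXn -rmorphMn -rmorphM lecR.
have -> : r * A = B by rewrite divfK// gt_eqF.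
have -> : r * a1 * (B + B) - B * (b1 + r * a1) =
    h * r * \sum_(j | j != i) eps j * cov w i j.
  have -> : \sum_(j | j != i) eps j * cov w i j = (B * a1 - A * b1) / h.
    rewrite /a1 /b1 ![_ * (h * _)]mulrCA -mulrBr mulrC mulKf ?gt_eqF//.
    rewrite !mulr_sumr -sumrB; apply: eq_bigr => j _.
    by rewrite /cov /B -/A; ring.
  by rewrite /r; field; rewrite !gt_eqF.
rewrite normrM (gtr0_norm (mulr_gt0 h0 r0)) (ger0_norm (addr_ge0 (ltW B0) (ltW B0))).
rewrite -subr_ge0 => H; rewrite -subr_ge0.
set X := `|_| in H *.
(* The Cauchy estimate reads h r X <= (2/h) (2B)^2. With r = B / A and h = d / 2 this becomes X <= 8
   A B / h^2 = 32 A B / d^2. *)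
have -> : 32 / d ^+ 2 * (A * B) - X =
    (A / (B * h)) * (h^-1 *+ 2 * (B + B) ^+ 2 - h * r * X).
  by rewrite /r /h; field; rewrite !gt_eqF.
apply: mulr_ge0 H; apply: divr_ge0; first exact: ltW.
by apply: mulr_ge0; exact: ltW.
Qed.

(* 2 h_i h_j <= h_i^2 + h_j^2 reduces the quadratic form to row sums. *)
Lemma variance_bound w K (h : 'I_n -> R) :
  (forall i, \sum_j `|cov w i j| <= K * (mass1 w i * total w)) ->
  \sum_i \sum_j h i * h j * cov w i j <= K * total w * \sum_i mass1 w i * h i ^+ 2.
Proof.
move=> wK.
have le1 : \sum_i \sum_j h i * h j * cov w i j <=
    \sum_i \sum_j (h i ^+ 2 / 2 + h j ^+ 2 / 2) * `|cov w i j|.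
  apply: ler_sum => i _; apply: ler_sum => j _.
  apply: le_trans (ler_norm _) _; rewrite normrM ler_wpM2r// ler_norml.
  have := sqr_ge0 (h i - h j); have := sqr_ge0 (h i + h j).
  rewrite sqrrD sqrrB => ? ?; apply/andP; split; lra.
apply: le_trans le1 _.
have -> : \sum_i \sum_j (h i ^+ 2 / 2 + h j ^+ 2 / 2) * `|cov w i j| =
    \sum_i h i ^+ 2 * \sum_j `|cov w i j|.
  transitivity (\sum_i \sum_j h i ^+ 2 / 2 * `|cov w i j| +
                \sum_i \sum_j h j ^+ 2 / 2 * `|cov w i j|).
    rewrite -big_split; apply: eq_bigr => i _; rewrite -big_split.
    by apply: eq_bigr => j _; rewrite mulrDl.
  rewrite [X in _ + X]exchange_big -big_split; apply: eq_bigr => i _ /=.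
  rewrite mulr_sumr -big_split; apply: eq_bigr => j _ /=.
  by rewrite [cov w j i]covC; field.
rewrite mulr_sumr; apply: ler_sum => i _.
have -> : K * total w * (mass1 w i * h i ^+ 2) =
  h i ^+ 2 * (K * (mass1 w i * total w)) by ring.
by rewrite ler_wpM2l// sqr_ge0.
Qed.

End Influence.

(** * Conditional measures and the local variance inequality *)

Section Links.
Local Open Scope complex_scope.
Variables (R : realType) (n k : nat).
Implicit Types (w f : ksubset n k -> R) (T : {set 'I_n}) (K : R).

(** Conditioning on T without deleting it: the link is still a weight on k-sets, and the elements of
    T have zero covariance with everything. *)
Definition link w T : ksubset n k -> R :=
  fun S => if T \subset val S then w S else 0.

Lemma link_ge0 w T S : (forall S', 0 <= w S') -> 0 <= link w T S.
Proof. by rewrite /link; case: ifP. Qed.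

Lemma poly_ge0_at0 (p : {poly R}) : (forall y, 0 < y -> 0 <= p.[y]) -> 0 <= p.[0].
Proof.
move=> p0; rewrite leNgt; apply/negP => pN.
have [d d0 /(_ (d / 2))] := poly_cont 0 p (ltac:(by rewrite oppr_gt0) : 0 < - p.[0]).
have d20 : 0 < d / 2 by rewrite divr_gt0.
rewrite subr0 gtr0_norm// => /(_ ltac:(lra)).
have := p0 _ d20; rewrite ltr_norml => ? /andP[_ ?]; lra.
Qed.

(** Dividing z_j by y for j in T keeps it in the cone and multiplies the S-term by y^(-|S :&: T|);
    the global factor y^|T| then makes the exponent nonnegative. At y = 0 only the sets containing T
    survive. *)
Lemma cone_stable_tilt d w T y : 0 < y ->
  cone_stable d w -> cone_stable d (fun S => w S * y ^+ #|T :\: val S|).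
Proof.
move=> y0 stab z zC.
pose z' j := if j \in T then y^-1%:C * z j else z j.
have z'C j : cone d (z' j).
  by rewrite /z'; case: ifP => // _; rewrite coneZ// invr_gt0.
have := stab z' z'C; apply: contra_neq => sum0.
have yn0 : (y%:C ^+ #|T|) != 0 :> R[i].
  by rewrite expf_eq0 (inj_eq (@complexI R) _ 0) gt_eqF// andbF.
apply: (mulfI yn0); rewrite mulr0 -[RHS]sum0 mulr_sumr; apply: eq_bigr => S _.
rewrite rmorphM rmorphXn mulrCA -mulrA; congr (_ * _).
have -> : \prod_(i in val S) z' i = y^-1%:C ^+ #|val S :&: T| * \prod_(i in val S) z i.
  rewrite (bigID (mem T)) [in RHS](bigID (mem T)) /= mulrA; congr (_ * _).
    rewrite (eq_bigr (fun j => y^-1%:C * z j)); last first.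
      by move=> j /andP[_ jT]; rewrite /z' jT.
    rewrite big_split /= prodr_const; congr (_ ^+ _ * _).
    by apply: eq_card => j; rewrite !inE.
  by apply: eq_bigr => j /andP[_ /negbTE jT]; rewrite /z' jT.
rewrite mulrA; congr (_ * _).
rewrite -(cardsID (val S) T) exprD [T :&: _]finset.setIC mulrAC -exprMn.
by rewrite -(rmorphM (real_complex R)) /= mulfV ?gt_eqF// expr1n mul1r.
Qed.

(** For the tilted weight both sides are polynomials in y. The inequality holds for y > 0 by
    [influence_bound] and passes by continuity to y = 0, where the tilted weight is the link. *)
Lemma link_influence_bound d w T (eps : 'I_n -> R) i :
  0 < d <= 1 -> (forall S, 0 <= w S) -> cone_stable d w ->
  (forall j, `|eps j| <= 1) ->
  \sum_(j | j != i) eps j * cov (link w T) i j <=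
  32 / d ^+ 2 * (mass1 (link w T) i * (total (link w T) - mass1 (link w T) i)).
Proof.
move=> d01 w0 stab eps1; set c := 32 / d ^+ 2.
pose W (S : ksubset n k) : {poly R} := (w S)%:P * 'X^#|T :\: val S|.
pose G := c%:P * (mass1 W i * (total W - mass1 W i)) -
  \sum_(j | j != i) (eps j)%:P * cov W i j.
have GE y (wy : ksubset n k -> R) : horner_eval y \o W =1 wy ->
    G.[y] = c * (mass1 wy i * (total wy - mass1 wy i)) -
      \sum_(j | j != i) eps j * cov wy i j.
  move=> /funext Wy.
  have totE : (total W).[y] = total wy by rewrite -Wy -total_morph.
  have massE : (mass1 W i).[y] = mass1 wy i by rewrite -Wy -mass1_morph.
  have covE j : (cov W i j).[y] = cov wy i j by rewrite -Wy -cov_morph.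
  rewrite /G hornerD hornerN 2!hornerM hornerC hornerD hornerN totE massE.
  rewrite horner_sum; congr (_ - _).
  by apply: eq_bigr => j _; rewrite hornerM hornerC covE.
rewrite -subr_ge0 -(GE 0); last first.
  move=> S; rewrite /= /horner_eval hornerM hornerC hornerXn expr0n.
  rewrite cards_eq0 finset.setD_eq0.
  by rewrite /link; case: ifP; rewrite ?mulr1 ?mulr0.
apply: poly_ge0_at0 => y y0.
rewrite (GE y (fun S => w S * y ^+ #|T :\: val S|)); last first.
  by move=> S; rewrite /= /horner_eval hornerM hornerC hornerXn.
rewrite subr_ge0; apply: le_trans (ler_norm _) _.
apply: influence_bound => // [S|]; first by rewrite mulr_ge0// exprn_ge0// ltW.
exact: cone_stable_tilt.
Qed.

Definition influence_bounded K w := forall i,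
  \sum_j `|cov w i j| <= K * (mass1 w i * total w).

(** Taking [eps] to be the signs of the covariances turns the signed sum into absolute values. The
    diagonal term, the variance of one indicator, accounts for the added 1. *)
Lemma link_influence_bounded d w T :
  0 < d <= 1 -> (forall S, 0 <= w S) -> cone_stable d w ->
  influence_bounded (32 / d ^+ 2 + 1) (link w T).
Proof.
move=> d01 w0 stab i; set v := link w T.
pose eps j : R := if 0 <= cov v i j then 1 else -1.
have eps1 j : `|eps j| <= 1 by rewrite /eps; case: ifP; rewrite ?normrN normr1.
have v0 S : 0 <= v S by apply: link_ge0.
have A0 : 0 <= mass1 v i by apply: sumr_ge0.
have B0 : 0 <= total v - mass1 v i by rewrite total_mass1; apply: sumr_ge0.
have D0 : 0 < d ^+ 2 by case/andP: d01 => d0 _; rewrite exprn_gt0.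
have := link_influence_bound T i d01 w0 stab eps1; rewrite -/v => le1.
rewrite (bigD1 i)//= mulrDl mul1r addrC lerD//.
  have -> : \sum_(j | j != i) `|cov v i j| = \sum_(j | j != i) eps j * cov v i j.
    apply: eq_bigr => j _; rewrite /eps; case: ifPn => [c0|c0].
      by rewrite ger0_norm ?mul1r.
    by rewrite ltr0_norm ?mulN1r// ltNge.
  apply: le_trans le1 _; rewrite ler_wpM2l ?divr_ge0 ?(ltW D0)//.
  by rewrite ler_wpM2l// lerBlDr lerDl.
have -> : cov v i i = mass1 v i * (total v - mass1 v i).
  by rewrite /cov mass2ii; ring.
by rewrite ger0_norm ?mulr_ge0// ler_wpM2l// lerBlDr lerDl.
Qed.

Lemma sum_mass1 w : \sum_j mass1 w j = k%:R * total w.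
Proof.
rewrite /mass1; under eq_bigr do rewrite big_mkcond.
rewrite exchange_big mulr_sumr; apply: eq_bigr => S _ /=.
by rewrite -big_mkcond sumr_const (eqP (valP S)) mulr_natl.
Qed.

Lemma mass1_le_total w j : (forall S, 0 <= w S) -> 0 <= mass1 w j <= total w.
Proof.
move=> w0; rewrite sumr_ge0//= -subr_ge0 total_mass1; exact: sumr_ge0.
Qed.

Lemma sum_weight_eq0 w (P : pred (ksubset n k)) S : (forall S, 0 <= w S) ->
  \sum_(S' | P S') w S' = 0 -> P S -> w S = 0.
Proof. by move=> w0 /(psumr_eq0P (fun S' _ => w0 S')); apply. Qed.

(** Let g_j be the conditional mean of f given j in S, minus the overall mean, and let G(S) be the
    sum of g_j over S. The left side equals both the weighted sum L of g_j^2 and the covariance of f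
    with G, while the influence bound makes the variance of G at most K L. *)
Lemma local_variance K w f : 0 < K -> (forall S, 0 <= w S) ->
  influence_bounded K w ->
  let wf S := w S * f S in
  \sum_j mass1 wf j ^+ 2 / mass1 w j - k%:R * (total wf ^+ 2 / total w) <=
  K * (\sum_S w S * f S ^+ 2 - total wf ^+ 2 / total w).
Proof.
move=> K0 w0 wK /=; set wf := fun S => w S * f S.
set Z := total w; set N := total wf; set m := N / Z.
(* Quotients by 0 are 0, which is consistent here: by nonnegativity, a vanishing mass forces the
   corresponding sum of [wf] to vanish. *)
have mZ : m * Z = N.
  rewrite /m; have [Z0|] := eqVneq Z 0; last by move=> ?; rewrite divfK.
  rewrite Z0 mulr0 /N /total big1// => S _.
  by rewrite /wf (sum_weight_eq0 (P := predT) w0 Z0)// mul0r.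
pose h j := mass1 wf j / mass1 w j.
have hA j : h j * mass1 w j = mass1 wf j.
  rewrite /h; have [A0|] := eqVneq (mass1 w j) 0; last by move=> ?; rewrite divfK.
  rewrite A0 mulr0 /mass1 big1// => S jS.
  by rewrite /wf (sum_weight_eq0 (P := fun S => j \in val S) w0 A0)// mul0r.
pose g j := h j - m; pose gS (S : ksubset n k) := \sum_(j in val S) g j.
pose L := \sum_j mass1 w j * g j ^+ 2.
have sg0 : \sum_j mass1 w j * g j = 0.
  transitivity (\sum_j mass1 wf j - m * \sum_j mass1 w j).
    rewrite mulr_sumr -sumrB; apply: eq_bigr => j _.
    by rewrite /g mulrBr -hA; ring.
  by rewrite !sum_mass1 -/Z -/N -mZ; ring.
have LE : \sum_j mass1 wf j ^+ 2 / mass1 w j - k%:R * (N ^+ 2 / Z) = L.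
  have -> : N ^+ 2 / Z = m * N by rewrite /m; ring.
  have -> : \sum_j mass1 wf j ^+ 2 / mass1 w j = \sum_j mass1 wf j * h j.
    by apply: eq_bigr => j _; rewrite /h; ring.
  transitivity (L + m * \sum_j mass1 w j * g j); last by rewrite sg0 mulr0 addr0.
  have -> : k%:R * (m * N) = m * \sum_j mass1 wf j by rewrite sum_mass1 -/N; ring.
  rewrite !mulr_sumr -sumrB -big_split; apply: eq_bigr => j _ /=.
  by rewrite -hA /g; ring.
have sum_gS (F : ksubset n k -> R) : \sum_S F S * gS S = \sum_j g j * mass1 F j.
  under eq_bigr do rewrite /gS big_mkcond mulr_sumr.
  rewrite exchange_big; apply: eq_bigr => j _.
  rewrite /mass1 big_mkcond [in RHS]big_mkcond mulr_sumr; apply: eq_bigr => S _ /=.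
  by case: ifP => _; ring.
have crossE : \sum_S w S * (f S - m) * gS S = L.
  transitivity (\sum_S wf S * gS S - m * \sum_S w S * gS S).
    by rewrite mulr_sumr -sumrB; apply: eq_bigr => S _; rewrite /wf; ring.
  rewrite !sum_gS mulr_sumr -sumrB; apply: eq_bigr => j _.
  by rewrite -hA /g; ring.
(* Since [gS] has mean zero by [sg0], its second moment is the covariance form. *)
have quadE : Z * \sum_S w S * gS S ^+ 2 = \sum_i \sum_j g i * g j * cov w i j.
  transitivity (Z * \sum_i \sum_j g i * g j * mass2 w i j -
      (\sum_j mass1 w j * g j) * \sum_j mass1 w j * g j); last first.
    rewrite mulr_suml mulr_sumr -sumrB; apply: eq_bigr => i _.
    rewrite !mulr_sumr -sumrB; apply: eq_bigr => j _.
    by rewrite /cov -/Z; ring.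
  rewrite sg0 mul0r subr0; congr (_ * _).
  transitivity (\sum_S w S * gS S * gS S); first by apply: eq_bigr => S _; ring.
  rewrite sum_gS; apply: eq_bigr => i _.
  transitivity (g i * \sum_(S : ksubset n k) (if i \in val S then w S else 0) * gS S).
    congr (_ * _); rewrite /mass1 big_mkcond; apply: eq_bigr => S _.
    by case: ifP; rewrite ?mul0r.
  rewrite sum_gS mulr_sumr; apply: eq_bigr => j _; rewrite mulrA; congr (_ * _).
  by rewrite /mass1 /mass2 -big_mkcondl; apply: eq_bigl => S; rewrite andbC.
have quad_le : \sum_S w S * gS S ^+ 2 <= K * L.
  have Z0 : 0 <= Z by apply: sumr_ge0.
  have [Ze|Zn] := eqVneq Z 0.
    rewrite big1 => [|S _].
      rewrite mulr_ge0 ?(ltW K0)//; apply: sumr_ge0 => j _.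
      by rewrite mulr_ge0 ?sqr_ge0// (proj1 (andP (mass1_le_total j w0))).
    by rewrite (sum_weight_eq0 (P := predT) w0 Ze)// mul0r.
  have {}Z0 : 0 < Z by rewrite lt_def Zn.
  rewrite -(ler_pM2l Z0) quadE (le_trans (variance_bound g wK))//.
  by rewrite -/Z -/L [K * Z]mulrC mulrA.
have varE : \sum_S w S * (f S - m) ^+ 2 = \sum_S w S * f S ^+ 2 - N ^+ 2 / Z.
  have -> : N ^+ 2 / Z = m * N by rewrite /m; ring.
  transitivity (\sum_S w S * f S ^+ 2 - m * 2 * N + m * (m * Z)).
    2: by rewrite mZ; ring.
  rewrite /N /Z /total !mulr_sumr -sumrB -big_split; apply: eq_bigr => S _ /=.
  by rewrite /wf; ring.
rewrite LE -varE; set V := \sum_S _.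
(* L is the covariance of f with sum_j g j; complete the square. *)
have : 0 <= \sum_S w S * (K * (f S - m) - gS S) ^+ 2.
  by apply: sumr_ge0 => S _; rewrite mulr_ge0 ?sqr_ge0.
have -> : \sum_S w S * (K * (f S - m) - gS S) ^+ 2 =
    K ^+ 2 * V - K * 2 * \sum_S w S * (f S - m) * gS S + \sum_S w S * gS S ^+ 2.
  rewrite /V !mulr_sumr -sumrB -big_split; apply: eq_bigr => S _ /=; ring.
rewrite crossE => sq0; rewrite -(ler_pM2l K0); nra.
Qed.

End Links.

(** * Contraction of variance along the levels *)

Lemma leq_bin_exp m p : ('C(m, p) <= m ^ p)%N.
Proof.
apply: (@leq_trans (m ^_ p)); first by rewrite -bin_ffact leq_pmulr ?fact_gt0.
elim: p => // p IHp; rewrite ffactnSr expnSr leq_mul//; exact: leq_subr.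
Qed.

(** Double counting: an element j of T leaves T unchanged, in i ways, and each (i+1)-set arises from
    i+1 pairs with j outside T. *)
Lemma sum_setU1 (V : comNzRingType) n (x : {set 'I_n} -> V) i :
  \sum_(T : {set 'I_n} | #|T| == i) \sum_j x (j |: T) =
  i.+1%:R * (\sum_(T : {set 'I_n} | #|T| == i.+1) x T) +
  i%:R * \sum_(T : {set 'I_n} | #|T| == i) x T.
Proof.
have sum_const m : \sum_(T : {set 'I_n} | #|T| == m) \sum_(j in T) x T =
    m%:R * \sum_(T : {set 'I_n} | #|T| == m) x T.
  rewrite mulr_sumr; apply: eq_bigr => T /eqP Tm.
  by rewrite sumr_const Tm mulr_natl.
rewrite -!sum_const addrC.
transitivity (\sum_(T : {set 'I_n} | #|T| == i) (\sum_(j in T) x (j |: T) +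
   \sum_(j | j \notin T) x (j |: T))).
  by apply: eq_bigr => T _; rewrite [LHS](bigID (mem T)).
rewrite big_split /=; congr (_ + _).
  apply: eq_bigr => T _; apply: eq_bigr => j jT.
  by rewrite (finset.setUidPr _)// finset.sub1set.
rewrite (exchange_big_dep predT)//= [RHS](exchange_big_dep predT)//=.
apply: eq_bigr => j _.
rewrite [RHS](reindex_onto (fun T => j |: T) (fun T => T :\ j)); last first.
  by move=> T /andP[_ jT]; exact: finset.setD1K.
apply: eq_bigl => T; rewrite cardsU1 in_setU1 eqxx /= andbT.
have [jT|jT] /= := boolP (j \in T).
  rewrite andbF; apply/esym/negbTE; rewrite negb_and orbC; apply/orP; left.
  by apply: contraTneq jT => <-; rewrite finset.setD11.
by rewrite andbT add1n eqSS finset.setU1K// eqxx andbT.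
Qed.

Section Levels.
Variables (R : realType) (n k : nat).
Implicit Types (w f : ksubset n k -> R) (T : {set 'I_n}).

Lemma mass1_link w T j : mass1 (link w T) j = total (link w (j |: T)).
Proof.
rewrite /mass1 /total big_mkcond; apply: eq_bigr => S _.
by rewrite /link finset.subUset finset.sub1set; case: (j \in val S).
Qed.

Lemma sum_link w i : \sum_(T : {set 'I_n} | #|T| == i) total (link w T) =
  'C(k, i)%:R * total w.
Proof.
rewrite /total exchange_big mulr_sumr; apply: eq_bigr => S _ /=.
rewrite /link -big_mkcondr sumr_const mulr_natl; congr (_ *+ _).
rewrite -[in RHS](eqP (valP S)) -cards_draws; apply: eq_card => T.
by rewrite !inE andbC.
Qed.

(** Up to the factor ['C(k, i)] times the total mass, this is the second moment of the conditional
    mean of f given a uniform i-subset T of the random set S. *)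
Definition level_energy w f i : R :=
  \sum_(T : {set 'I_n} | #|T| == i)
    total (link (fun S => w S * f S) T) ^+ 2 / total (link w T).

Definition energy w f : R := \sum_S w S * f S ^+ 2.

(** This is [local_variance] summed over the links of all i-sets. The i elements already in T reduce
    the coefficient k to k - i. *)
Lemma level_energy_step (K : R) w f i : 0 < K -> (i <= k)%N ->
  (forall S, 0 <= w S) -> (forall T, influence_bounded K (link w T)) ->
  i.+1%:R * level_energy w f i.+1 - (k - i)%:R * level_energy w f i <=
  K * ('C(k, i)%:R * energy w f - level_energy w f i).
Proof.
move=> K0 ik w0 wK.
set wf := fun S => w S * f S.
pose x T := total (link wf T) ^+ 2 / total (link w T).
have le1 T : \sum_j x (j |: T) - k%:R * x T <=
    K * (total (link (fun S => w S * f S ^+ 2) T) - x T).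
  have /= := local_variance f K0 (fun S => link_ge0 T S w0) (wK T).
  have linkM g : (fun S => link w T S * g S) = link (fun S => w S * g S) T.
    by apply/funext => S; rewrite /link; case: ifP; rewrite ?mul0r.
  rewrite linkM; under eq_bigr do rewrite !mass1_link.
  by rewrite -(linkM (fun S => f S ^+ 2)).
have := ler_sum (index_enum {set 'I_n}) (P := fun T => #|T| == i) (fun T _ => le1 T).
rewrite !sumrB -!mulr_sumr sumrB sum_link sum_setU1 -/(level_energy w f i.+1).
rewrite -/(level_energy w f i) natrB// /energy /total.
set X := level_energy _ _ _; set Y := level_energy _ _ _ => le2.
apply: le_trans le2; rewrite le_eqVlt; apply/orP; left; apply/eqP; ring.
Qed.

(** Let D_i be the sum over i-sets of the conditional variances, ['C(k, i)] times the energy minus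
    the level energy. The step says (i+1) D_(i+1) >= (k-i-K) D_i. After division by ['C(k, i)] the
    factors (k-i-K)/(k-i) are ratios of consecutive ['C(k - i, K)] and telescope. *)
Lemma level_energy_decay (K : nat) w f i : (0 < K)%N -> (i <= k - K)%N -> (K <= k)%N ->
  (forall S, 0 <= w S) -> (forall T, influence_bounded K%:R (link w T)) ->
  'C(k, i)%:R * 'C(k - i, K)%:R * (energy w f - level_energy w f 0) <=
  'C(k, K)%:R * ('C(k, i)%:R * energy w f - level_energy w f i).
Proof.
move=> K0 + Kk w0 wK; elim: i => [|i IHi] ik.
  by rewrite subn0 bin0 !mul1r.
have {}IHi := IHi (ltnW ik).
have iKk : (i + K < k)%N by lia.
have step := level_energy_step f (_ : 0 < K%:R) (ltac:(lia) : (i <= k)%N) w0 wK.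
have {}step := step ltac:(by rewrite ltr0n).
set D0 := energy _ _ - _ in IHi *; set E := energy _ _ in IHi step *.
set X := level_energy w f i in IHi step *; set X' := level_energy w f i.+1 in step *.
have i0 : 0 < i.+1%:R :> R by rewrite ltr0n.
have binE : i.+1%:R * 'C(k, i.+1)%:R = (k - i)%:R * 'C(k, i)%:R :> R.
  by rewrite -!natrM mul_bin_left.
have binE' : (k - i)%:R * 'C(k - i.+1, K)%:R = ((k - i)%:R - K%:R) * 'C(k - i, K)%:R :> R.
  by rewrite -natrB -?natrM ?subnS ?mul_bin_down//; lia.
have kiK : 0 <= (k - i)%:R - K%:R :> R by rewrite subr_ge0 ler_nat; lia.
rewrite -(ler_pM2l i0).
have -> : i.+1%:R * ('C(k, i.+1)%:R * 'C(k - i.+1, K)%:R * D0) =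
   ((k - i)%:R - K%:R) * ('C(k, i)%:R * 'C(k - i, K)%:R * D0).
  rewrite !mulrA binE -[_ * 'C(k, i)%:R * _]mulrAC binE'; ring.
apply: le_trans (ler_wpM2l kiK IHi) _.
have -> : i.+1%:R * ('C(k, K)%:R * ('C(k, i.+1)%:R * E - X')) =
  'C(k, K)%:R * ((k - i)%:R * 'C(k, i)%:R * E - i.+1%:R * X') by rewrite -binE; ring.
rewrite mulrCA ler_wpM2l//; move: step; nra.
Qed.

Lemma level_energy_contraction (K : nat) w f : (0 < K)%N -> (0 < k)%N ->
  (forall S, 0 <= w S) -> (forall T, influence_bounded K%:R (link w T)) ->
  \sum_S w S * f S = 0 ->
  level_energy w f (k - K)%N / 'C(k, k - K)%:R <=
  (1 - (k%:R ^+ K)^-1) * energy w f.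
Proof.
move=> K0 k0 w0 wK wf0.
have E0 : 0 <= energy w f by apply: sumr_ge0 => S _; rewrite mulr_ge0 ?sqr_ge0.
have X0 : level_energy w f 0 = 0.
  rewrite /level_energy big1// => T; rewrite cards_eq0 => /eqP ->.
  rewrite [total (link _ _)](_ : _ = 0) ?expr0n ?mul0r// -[RHS]wf0.
  by apply: eq_bigr => S _; rewrite /link finset.sub0set.
have kK1 : 1 <= k%:R ^+ K :> R by rewrite exprn_ege1// ler1n.
have kKp := lt_le_trans ltr01 kK1.
have [kK|Kk] := ltnP k K.
  (* Truncated subtraction puts the walk at level 0, where the energy of a mean-zero f vanishes. *)
  have -> : (k - K = 0)%N by lia.
  rewrite X0 mul0r mulr_ge0// subr_ge0 invf_le1//.
have := level_energy_decay f K0 (leqnn _) Kk w0 wK.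
rewrite X0 subr0 (_ : k - (k - K) = K)%N ?binn ?mulr1; last by lia.
have b0 : 0 < 'C(k, k - K)%:R :> R by rewrite ltr0n bin_gt0; lia.
have c0 : 0 < 'C(k, K)%:R :> R by rewrite ltr0n bin_gt0.
have cK : 'C(k, K)%:R <= k%:R ^+ K :> R by rewrite -natrX ler_nat leq_bin_exp.
rewrite ler_pdivrMr//; set b := 'C(k, k - K)%:R in b0 *.
set X := level_energy _ _ _ => decay.
have D0 : 0 <= b * energy w f - X.
  by rewrite -(pmulr_rge0 _ c0) (le_trans _ decay)// mulr_ge0// ltW.
have := le_trans decay (ler_wpM2r D0 cK).
rewrite -(ler_pM2l (x := (k%:R ^+ K)^-1)) ?invr_gt0// mulKf ?gt_eqF//; lra.
Qed.

End Levels.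

(** * Second eigenvalue and the walk *)

Section RankOne.

(** Block elimination computes det B times det M in two ways; the nonzero factor det M is then
    cancelled. The adjugate avoids inverting M over the polynomial ring. *)
Lemma det_add_rank_one (D : idomainType) m (M : 'M[D]_m) (u : 'cV_m) (v : 'rV_m) :
  \det M != 0 -> \det (M + u *m v) = \det M + (v *m \adj M *m u) 0 0.
Proof.
move=> M0; pose B := block_mx M (- u) v 1%:M.
have detB : \det B = \det (M + u *m v).
  have -> : B = block_mx (M + u *m v) (- u) 0 1%:M *m block_mx 1%:M 0 v 1%:M.
    rewrite mulmx_block !mulmx1 !mulmx0 !mul1mx !add0r mulNmx.
    by rewrite addrK.
  by rewrite det_mulmx det_ublock det_lblock !det1 !mulr1.
have := congr1 determinant (_ : B *m block_mx 1%:M (\adj M *m u) 0 (\det M)%:M =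
   block_mx M 0 v (v *m \adj M *m u + (\det M)%:M)).
rewrite det_mulmx detB det_ublock det_lblock det1 mul1r det_scalar1 det_mx11.
rewrite !mxE eqxx mulr1n addrC mulrC => H.
apply: (mulfI M0); rewrite H //.
rewrite mulmx_block !mulmx1 !mulmx0 !addr0 mul1mx mulmxA mul_mx_adj.
by rewrite mul_scalar_mx mul_mx_scalar scalerN subrr mulmxA.
Qed.

(** Subtracting u v replaces one eigenvalue 1 of P by 0, which exposes the multiplicity of 1. *)
Lemma char_poly_deflate (F : fieldType) m (P : 'M[F]_m) (u : 'cV_m) (v : 'rV_m) :
  P *m u = u -> v *m u = 1%:M ->
  ('X - 1) * char_poly (P - u *m v) = 'X * char_poly P.
Proof.
move=> Pu vu; set M := char_poly_mx P.
set U := map_mx polyC u; set V := map_mx polyC v.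
have ME : char_poly_mx (P - u *m v) = M + U *m V.
  by rewrite /M /char_poly_mx map_mxB map_mxM opprB addrA addrAC.
have M0 : \det M != 0 by apply: monic_neq0; apply: char_poly_monic.
rewrite /char_poly ME (det_add_rank_one _ _ M0) mulrDr.
have MU : M *m U = ('X - 1) *: U.
  rewrite /M /char_poly_mx mulmxBl mul_scalar_mx -map_mxM Pu.
  by rewrite scalerBl scale1r.
have adjU : ('X - 1) *: (\adj M *m U) = \det M *: U.
  by rewrite scalemxAr -MU mulmxA mul_adj_mx mul_scalar_mx.
have -> : ('X - 1) * (V *m \adj M *m U) 0 0 = \det M.
  transitivity ((('X - 1) *: (V *m \adj M *m U)) 0 0); first by rewrite [RHS]mxE.
  rewrite -mulmxA scalemxAr adjU -scalemxAr -map_mxM vu map_mx1 !mxE eqxx.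
  by rewrite mulr1.
by ring.
Qed.

End RankOne.

Section Spectrum.
Variables (R : realType).
Implicit Types (m : R -> nat) (s : seq R).

Let repeat_seq m s : seq R := flatten [seq nseq (m x) x | x <- s].

Lemma mem_repeat m s x : x \in repeat_seq m s -> x \in s.
Proof. by move=> /flatten_mapP[y ys]; rewrite mem_nseq => /andP[_ /eqP ->]. Qed.

Lemma pairwise_repeat m s : pairwise >%R s -> pairwise >=%R (repeat_seq m s).
Proof.
elim: s => // x s IHs /= /andP[xs /IHs IH].
rewrite /repeat_seq /= pairwise_cat IH andbT; apply/andP; split.
  apply/allrelP => y z; rewrite mem_nseq => /andP[_ /eqP ->] /mem_repeat zs.
  by rewrite /= ltW//; move/allP: xs; apply.
elim: (m x) => //= p ->; rewrite andbT; apply/allP => y.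
by rewrite mem_nseq => /andP[_ /eqP ->] /=.
Qed.

Lemma count_repeat m s x : uniq s -> (count_mem x (repeat_seq m s) <= m x)%N.
Proof.
elim: s => // y s IHs /= /andP[ys /IHs IH].
rewrite /repeat_seq /= count_cat count_nseq /=.
case: eqVneq ys => [->|_] ys /=; last by rewrite mul0n.
rewrite mul1n (count_memPn _) ?addn0//.
by apply: contra ys => /mem_repeat.
Qed.

(** A left eigenvector for an eigenvalue other than 1 has sum zero, so the hypothesis bounds that
    eigenvalue by t. It remains to exclude that 1 is repeated. *)
Lemma second_eigenvalue_le N (P : 'M[R]_N) (t : R) : (0 < N)%N -> 0 <= t < 1 ->
  P *m const_mx 1 = (const_mx 1 : 'cV_N) ->
  (forall x (v : 'rV_N), v != 0 -> v *m P = x *: v ->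
     v *m (const_mx 1 : 'cV_N) = 0 -> x <= t) ->
  second_eigenvalue P <= t.
Proof.
move=> N0 /andP[t0 t1] P1 Pt; set u : 'cV_N := const_mx 1 in P1 Pt.
have chi0 : char_poly P != 0 by apply: monic_neq0; apply: char_poly_monic.
have root_le x : root (char_poly P) x -> x != 1 -> x <= t.
  rewrite -eigenvalue_root_char => /eigenvalueP[v vP v0] x1; apply: (Pt x v v0 vP).
  have : (x - 1) *: (v *m u) = 0.
    by rewrite scalerBl scale1r scalemxAl -vP -mulmxA P1 subrr.
  by move/eqP; rewrite scaler_eq0 subr_eq0 (negbTE x1) => /eqP.
have mult1 : (mup 1 (char_poly P) <= 1)%N.
  (* A double eigenvalue 1 survives the deflation of the constant vector, and a
     left eigenvector of the deflated matrix has sum 0. *)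
  rewrite leqNgt mup_geq//; apply/negP => /dvdpP[q qE].
  pose v : 'rV[R]_N := delta_mx 0 (Ordinal N0).
  have vu : v *m u = 1%:M.
    by rewrite -rowE; apply/rowP => j; rewrite !mxE ord1.
  have := char_poly_deflate P1 vu; rewrite qE => defl.
  have X1 : 'X - 1 != 0 :> {poly R} by rewrite polyXsubC_eq0.
  have rootP' : root (char_poly (P - u *m v)) 1.
    have -> : char_poly (P - u *m v) = 'X * q * ('X - 1).
      by apply: (mulfI X1); rewrite defl polyC1; ring.
    by rewrite rootM orbC root_XsubC eqxx.
  rewrite -eigenvalue_root_char in rootP'.
  have /eigenvalueP[y yP y0] := rootP'; rewrite scale1r in yP.
  have yu : y *m u = 0.
    have := congr1 (mulmx^~ u) yP.
    rewrite mulmxBr mulmxBl -mulmxA P1 mulmxA -[_ *m v *m u]mulmxA vu mulmx1 subrr.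
    by [].
  have : 1 <= t.
    apply: (Pt 1 y y0 _ yu); rewrite scale1r -[RHS]yP mulmxBr mulmxA yu mul0mx.
    by rewrite subr0.
  by rewrite leNgt t1.
have mem_root x : x \in eigenvalues P -> root (char_poly P) x.
  by move/mem_repeat; rewrite mem_rev -(roots_on_rootsR chi0) => /andP[].
have uniq_r : uniq (rev (rootsR (char_poly P))).
  by rewrite rev_uniq lt_sorted_uniq// sorted_roots.
have pw : pairwise >=%R (eigenvalues P).
  apply: pairwise_repeat; rewrite -sorted_pairwise ?rev_sorted; last first.
    by move=> a b c /= ba cb; apply: lt_trans ba.
  exact: sorted_roots.
have := count_repeat (fun x => mup x (char_poly P)) 1 uniq_r.
rewrite /repeat_seq -/(eigenvalues P) => cnt.
rewrite /second_eigenvalue.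
(* With fewer than two entries the default value 0 is at most t. Otherwise a second entry above t
   would force both leading entries to be 1, contradicting multiplicity one. *)
case: (eigenvalues P) pw cnt mem_root => [|x0 [|x1 e]] //=.
move=> /andP[/andP[x10 _] _] cnt mem_root; rewrite leNgt; apply/negP => tx1.
have is1 x : x \in [:: x0, x1 & e] -> t < x -> x = 1.
  move=> /mem_root rx tx; apply/eqP; apply: contraTT tx => x1'.
  by rewrite -leNgt root_le.
have e1 : x1 = 1 by apply: is1; rewrite ?inE ?eqxx ?orbT.
have e0 : x0 = 1 by apply: is1; rewrite ?inE ?eqxx// (lt_le_trans tx1).
by move: cnt; rewrite e0 e1 eqxx !add1n => /leq_trans/(_ mult1).
Qed.

Lemma relaxation_time_le N (P : 'M[R]_N) (b : R) : 0 < b ->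
  second_eigenvalue P <= 1 - b^-1 -> (relaxation_time P <= b%:E)%E.
Proof.
move=> b0 le1; have bV : 0 < b^-1 by rewrite invr_gt0.
rewrite /relaxation_time ifT; last by rewrite (le_lt_trans le1)// gtrBl.
by rewrite lee_fin -[leRHS]invrK lef_pV2 ?posrE ?subr_gt0; lra.
Qed.

End Spectrum.

(** * The quadratic form of the down-up walk *)

Section Walk.
Variables (R : realType) (n k l : nat) (mu : ksubset n k -> R).
Hypothesis mu0 : forall S, 0 <= mu S.

Lemma sum_ksubset (F : {set 'I_n} -> R) :
  \sum_(T : ksubset n l) F (val T) = \sum_(T : {set 'I_n} | #|T| == l) F T.
Proof. exact/esym/(big_sub (fun T : {set 'I_n} => #|T| == l)). Qed.

Lemma sum_walk_states (F : ksubset n k -> R) : (forall S, mu S = 0 -> F S = 0) ->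
  \sum_(i < #|walk_states mu|) F (enum_val i) = \sum_S F S.
Proof.
move=> F0; rewrite -big_enum_val big_mkcond; apply: eq_bigr => S _.
rewrite inE; case: ifPn => //; rewrite lt_def mu0 andbT negbK => /eqP /F0 //.
Qed.

Lemma mu_walk_state (i : 'I_#|walk_states mu|) : 0 < mu (enum_val i).
Proof. by have := enum_valP i; rewrite inE. Qed.

Lemma up_prob_mu0 (T : ksubset n l) S : mu S = 0 -> up_prob mu T S = 0.
Proof. by rewrite /up_prob => ->; rewrite mul0r if_same. Qed.

Lemma sum_over_link w (T : ksubset n l) :
  \sum_(S : ksubset n k | val T \subset val S) w S = total (link w (val T)) :> R.
Proof. exact: big_mkcond. Qed.

Lemma down_up_matrix_stochastic : (l <= k)%N ->
  down_up_matrix mu l *m const_mx 1 = (const_mx 1 : 'cV_#|walk_states mu|).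
Proof.
move=> lk; apply/colP => i; rewrite !mxE.
under eq_bigr do rewrite !mxE mulr1.
rewrite exchange_big /=.
set S := enum_val i.
have up1 (T : ksubset n l) : val T \subset val S ->
    \sum_(j < #|walk_states mu|) up_prob mu T (enum_val j) = 1.
  move=> TS; rewrite (sum_walk_states (up_prob_mu0 T)).
  rewrite /up_prob -big_mkcond -mulr_suml divff// gt_eqF//.
  by rewrite (bigD1 S)//= ltr_pwDl ?mu_walk_state ?sumr_ge0.
transitivity (\sum_(T : ksubset n l) down_prob R S T).
  apply: eq_bigr => T _; rewrite -mulr_sumr /down_prob.
  by case: ifPn => [/up1 ->|_]; rewrite ?mulr1 ?mul0r.
rewrite /down_prob (sum_ksubset (fun T => if T \subset val S then _ else 0)).
rewrite -big_mkcondr sumr_const.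
have -> : #|[pred T : {set 'I_n} | (#|T| == l) && (T \subset val S)]| = 'C(k, l).
  rewrite -[in RHS](eqP (valP S)) -cards_draws; apply: eq_card => T.
  by rewrite !inE andbC.
by rewrite -[LHS]mulr_natr mulVf// pnatr_eq0 -lt0n bin_gt0.
Qed.

(** The density of the signed measure v relative to [mu]. The sum has at most one term, and is empty
    off the support, which extends v to all k-sets. *)
Definition density (v : 'rV[R]_#|walk_states mu|) (S : ksubset n k) : R :=
  (\sum_(i | enum_val i == S) v 0 i) / mu S.

Lemma mu_density v i : mu (enum_val i) * density v (enum_val i) = v 0 i.
Proof.
rewrite mulrC /density divfK ?gt_eqF ?mu_walk_state//.
by rewrite (eq_bigl (pred1 i)) ?big_pred1_eq// => j; rewrite (inj_eq enum_val_inj).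
Qed.

Lemma sum_density v :
  \sum_S mu S * density v S = (v *m (const_mx 1 : 'cV_#|walk_states mu|)) 0 0.
Proof.
rewrite -sum_walk_states => [|S ->]; last by rewrite mul0r.
by rewrite mxE; apply: eq_bigr => i _; rewrite mu_density mxE mulr1.
Qed.

Lemma energy_density v :
  energy mu (density v) = \sum_i v 0 i * density v (enum_val i).
Proof.
rewrite /energy -sum_walk_states => [|S ->]; last by rewrite mul0r.
by apply: eq_bigr => i _; rewrite -mu_density expr2 mulrA.
Qed.

Lemma energy_density_gt0 (v : 'rV_#|walk_states mu|) :
  v != 0 -> 0 < energy mu (density v).
Proof.
have term_ge0 S : 0 <= mu S * density v S ^+ 2 by rewrite mulr_ge0 ?sqr_ge0.
move=> v0; rewrite lt_def sumr_ge0 ?andbT//; apply: contraNneq v0 => e0.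
apply/eqP/rowP => i; rewrite mxE -mu_density.
have /eqP : mu (enum_val i) * density v (enum_val i) ^+ 2 = 0.
  exact: (psumr_eq0P (fun S _ => term_ge0 S) e0).
by rewrite mulf_eq0 gt_eqF ?mu_walk_state//= sqrf_eq0 => /eqP ->; rewrite mulr0.
Qed.

(** The form factors through the l-sets: the down step gathers the mass of f over the sets
    containing T, and the up step averages f over them. Each T thus contributes the square of its
    conditional mean. *)
Lemma down_up_dirichlet v :
  \sum_j (v *m down_up_matrix mu l) 0 j * density v (enum_val j) =
  level_energy mu (density v) l / 'C(k, l)%:R.
Proof.
set f := density v.
pose N (T : {set 'I_n}) := total (link (fun S => mu S * f S) T).
have vP j : (v *m down_up_matrix mu l) 0 j =
    \sum_(T : ksubset n l) N (val T) / 'C(k, l)%:R * up_prob mu T (enum_val j).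
  rewrite mxE; under eq_bigr do rewrite mxE mulr_sumr.
  rewrite exchange_big; apply: eq_bigr => T _ /=.
  under eq_bigr do rewrite -mu_density mulrA.
  rewrite -mulr_suml; congr (_ * _).
  rewrite (sum_walk_states (F := fun S => mu S * density v S * down_prob R S T));
    last first.
    by move=> S ->; rewrite !mul0r.
  rewrite /N /total mulr_suml; apply: eq_bigr => S _.
  by rewrite /down_prob /link; case: ifP; rewrite ?mulr0 ?mul0r.
under eq_bigr do rewrite vP mulr_suml.
rewrite exchange_big /level_energy mulr_suml -sum_ksubset; apply: eq_bigr => T _ /=.
rewrite -/(N _) (sum_walk_states
  (F := fun S => N (val T) / 'C(k, l)%:R * up_prob mu T S * f S)); last first.
  by move=> S /up_prob_mu0 ->; rewrite mulr0 mul0r.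
transitivity (N (val T) / 'C(k, l)%:R * (N (val T) / total (link mu (val T)))).
  2: by ring.
have -> : N (val T) / total (link mu (val T)) = \sum_S up_prob mu T S * f S.
  rewrite {1}/N {1}/total mulr_suml; apply: eq_bigr => S _.
  rewrite /up_prob sum_over_link /link; case: ifP => _; last by rewrite !mul0r.
  by rewrite mulrAC.
by rewrite mulr_sumr; apply: eq_bigr => S _; rewrite [RHS]mulrA.
Qed.

End Walk.

(** * From sector stability to cone stability *)

Section SectorCone.
Local Open Scope complex_scope.
Variable R : realType.

Lemma cone_sub_sector (alpha : R) : 0 < alpha <= 1 ->
  exists2 d : R, 0 < d <= 1 & forall z, cone d z -> sector alpha z.
Proof.
(* [t] is half of the half-aperture, so that |arg z| <= t lies strictly inside the open sector. *)
move=> /andP[a0 a1]; pose t := alpha * pi / 2 / 2.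
have pi0 := pi_gt0 R.
have t0 : 0 < t by rewrite !divr_gt0 ?mulr_gt0.
have t2 : t < pi / 2 by rewrite /t; nra.
have tan0 : 0 < tan t.
  rewrite /tan divr_gt0// ?sin_gt0_pihalf ?cos_gt0_pihalf ?t0//.
  by rewrite t2 andbT (lt_trans _ t0)// oppr_lt0 divr_gt0.
exists (Num.min 1 (tan t)); first by rewrite lt_min ltr01 tan0 ge_min lexx.
case=> a b /andP[/= ap bd].
have bt : `|b / a| <= tan t.
  rewrite normrM normfV (gtr0_norm ap) ler_pdivrMr//.
  by apply: le_trans bd _; rewrite ler_wpM2r ?(ltW ap)// ge_min lexx orbT.
pose y := atan (b / a).
have tanK' : atan (tan t) = t.
  by rewrite tanK// in_itv/= t2 andbT (lt_trans _ t0)// oppr_lt0 divr_gt0.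
have yt : `|y| <= t.
  move: bt; rewrite !ler_norml => /andP[lo hi]; rewrite -tanK' -atanN.
  by rewrite !le_atan.
have cos0 : 0 < cos y by rewrite cos_gt0_pihalf// atan_gtNpi2 atan_ltpi2.
(* The argument of a + ib is atan(b/a) and its modulus is a / cos y. *)
exists (ln (a / cos y)), y.
have tt : alpha * pi / 2 = t + t by rewrite /t; field.
move: yt; rewrite ler_norml => /andP[? ?]; split; [lra|lra|].
rewrite /cexp lnK ?posrE ?divr_gt0//; congr (_ +i* _); first by rewrite divfK ?gt_eqF.
have := atanK (b / a); rewrite -/y /tan => sc.
rewrite mulrAC -mulrA sc; field; exact: lt0r_neq0.
Qed.

Lemma meval_gen_poly n k (mu : ksubset n k -> R) (z : 'I_n -> R[i]) :
  meval z (gen_poly mu) = \sum_(S : ksubset n k) (mu S)%:C * \prod_(i in val S) z i.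
Proof.
rewrite /gen_poly (big_morph (meval z) (mevalD z) (meval0 z)); apply: eq_bigr => S _.
rewrite mevalZ (big_morph (meval z) (mevalM z) (meval1 z)); congr (_ * _).
by apply: eq_bigr => i _; rewrite mevalXU.
Qed.

(** The zero polynomial counts as sector stable but not as cone stable; it is excluded by evaluating
    at 1, which gives the total mass of [mu]. *)
Lemma sector_stable_cone (alpha d : R) n k (mu : ksubset n k -> R) :
  (forall z, cone d z -> sector alpha z) ->
  (forall S, 0 <= mu S) -> (exists S, mu S != 0) ->
  sector_stable alpha (gen_poly mu) -> cone_stable d mu.
Proof.
move=> sub mu0 [S0 S0n] [g0|stab] z zC.
  2: by rewrite -meval_gen_poly stab// => i; apply: sub.
have := meval_gen_poly mu (fun=> 1); rewrite g0 meval0.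
under eq_bigr do rewrite big1 ?mulr1//.
rewrite -rmorph_sum => /esym/eqP; rewrite (inj_eq (@complexI R) _ 0) => /eqP sum0.
by case/eqP: S0n; apply: (psumr_eq0P (fun S _ => mu0 S) sum0).
Qed.

End SectorCone.

Theorem theorem1p4 (R : realType) (alpha : R) :
  0 < alpha <= 1 ->
  exists C c : R, [/\ 0 < C, 0 < c &
    forall (n k : nat) (mu : ksubset n k -> R),
      (1 <= k <= n)%N ->
      (forall S, 0 <= mu S) ->
      (exists S, mu S != 0) ->
      sector_stable alpha (gen_poly mu) ->
      exists l : nat,
        [/\ Num.max 0 (k%:R - C) <= l%:R, (l <= k)%N &
            (relaxation_time (down_up_matrix mu l) <= (C * k%:R `^ c)%:E)%E]].
Proof.
move=> alpha01; have [d d01 sub] := cone_sub_sector alpha01.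
pose b : R := 32 / d ^+ 2 + 1; pose K := (Num.bound b).+1.
have b0 : 0 <= b by rewrite addr_ge0 ?divr_ge0 ?sqr_ge0.
have bK : b <= K%:R.
  by rewrite (le_trans (ltW (archi_boundP b0)))// ler_nat.
(* The walk to level k - K has relaxation time at most k^K, so [K] serves both as the constant and
   as the exponent. *)
exists K%:R, K%:R; split; rewrite ?ltr0n//.
move=> n k mu /andP[k0 _] mu0 mun stab.
have cstab := sector_stable_cone sub mu0 mun stab.
have infl T : influence_bounded K%:R (link mu T).
  move=> i; apply: le_trans (link_influence_bounded T d01 mu0 cstab i) _.
  rewrite ler_wpM2r// mulr_ge0// sumr_ge0// => S *; exact: link_ge0.
exists (k - K)%N; split; rewrite ?leq_subr//.
  by rewrite ge_max ler0n lerBlDr -natrD ler_nat; lia.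
have k1 : 1 <= k%:R :> R by rewrite ler1n.
have kK1 : 1 <= k%:R ^+ K :> R by rewrite exprn_ege1.
have kKp := lt_le_trans ltr01 kK1.
apply: (@le_trans _ _ (k%:R ^+ K)%:E); last first.
  by rewrite lee_fin powR_mulrn// ler_peMl ?(ltW kKp)// ler1n.
apply: relaxation_time_le => //; apply: second_eigenvalue_le.
- have [S Sn] := mun; apply/card_gt0P; exists S; rewrite inE lt_def Sn; exact: mu0.
- by rewrite subr_ge0 invf_le1// kK1 gtrBl invr_gt0.
- by apply: down_up_matrix_stochastic => //; apply: leq_subr.
move=> x v v0 vP v1.
(* Pairing v P = x v with the density of v expresses x as a ratio of level energy to energy; v
   having sum zero makes the density mean-zero, so the contraction applies. *)
rewrite -(ler_pM2r (energy_density_gt0 mu0 v0)).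
have -> : x * energy mu (density v) =
    level_energy mu (density v) (k - K)%N / 'C(k, k - K)%:R.
  rewrite -down_up_dirichlet// vP energy_density// mulr_sumr.
  by apply: eq_bigr => i _; rewrite mxE mulrA.
apply: level_energy_contraction => //.
by rewrite sum_density// v1 mxE.
Qed.
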